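(* Let $H=\{1,\dots,n\}^3$ with $3n^2$ line switches: for every $i,j,k\in\{1,\dots,n\}$ there are switches $\ell_{ij},\ell_{ik},\ell_{jk}\in\{-1,+1\}$ on the axis-parallel lines $\{x=i,y=j\}$, $\{x=i,z=k\}$, $\{y=j,z=k\}$ respectively. For an initial configuration $a_{ijk}\in\{-1,+1\}$, the signed discrepancy is $\sum_{i,j,k=1}^n a_{ijk}\,\ell_{ij}\,\ell_{ik}\,\ell_{jk}$, and $F(H)=\min_{(a_{ijk})}\max_{\text{switches}}\sum_{i,j,k}a_{ijk}\ell_{ij}\ell_{ik}\ell_{jk}$. Then $F(H)=\Theta(n^{5/2})$; more precisely, $F(H)\le (6\ln 2)^{1/2}\,n^{5/2}$ and $F(H)\ge(1+o(1))\sqrt{2/\pi}\,n^{5/2}$.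
   Context: The minimum is over all assignments $a_{ijk}\in\{-1,+1\}$, $(i,j,k)\in\{1,\dots,n\}^3$, and the maximum is over all $2^{3n^2}$ settings of the switches $\ell_{ij},\ell_{ik},\ell_{jk}\in\{-1,+1\}$. *)

(* Defs.v *)
From HB Require Import structures.
From mathcomp Require Import all_boot all_order all_algebra.
From mathcomp Require Import all_classical all_reals all_analysis.

Set Implicit Arguments.
Unset Strict Implicit.
Unset Printing Implicit Defensive.

Import Order.TTheory GRing.Theory Num.Theory.
Import numFieldNormedType.Exports.

Local Open Scope ring_scope.

(* Elements of {-1, +1} are encoded by booleans: false is +1, true is -1. *)
Definition sgn (b : bool) : int := (-1) ^+ b.

Definition config (n : nat) : finType := {ffun 'I_n * 'I_n * 'I_n -> bool}.

(* One switch for each axis-parallel line in a given direction, indexed by the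
   two coordinates that are constant along the line. *)
Definition lines (n : nat) : finType := {ffun 'I_n * 'I_n -> bool}.

(* The three components are the families l_ij, l_ik and l_jk. *)
Definition switches (n : nat) : finType := (lines n * lines n * lines n)%type.

Definition disc (n : nat) (a : config n) (l : switches n) : int :=
  let: (lij, lik, ljk) := l in
  \sum_(i < n) \sum_(j < n) \sum_(k < n)
    sgn (a (i, j, k)) * sgn (lij (i, j)) * sgn (lik (i, k)) * sgn (ljk (j, k)).

(* The points at which the extrema below start only witness nonemptiness; the
   extremal values do not depend on them. *)
Definition config0 (n : nat) : config n := [ffun=> false].
Definition switches0 (n : nat) : switches n :=
  ([ffun=> false], [ffun=> false], [ffun=> false]).

Definition maxdisc (n : nat) (a : config n) : int :=
  disc a [arg max_(l > switches0 n) disc a l]%O.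

Definition F (n : nat) : int :=
  maxdisc [arg min_(a < config0 n) maxdisc a]%O.

(* Main.v *)
Require Import Defs.
From HB Require Import structures.
From mathcomp Require Import all_boot all_order all_algebra.
From mathcomp Require Import all_classical all_reals all_analysis.
From mathcomp Require Import zify ring lra.

Set Implicit Arguments.
Unset Strict Implicit.
Unset Printing Implicit Defensive.

Import Order.TTheory GRing.Theory Num.Theory.
Import numFieldNormedType.Exports.

Local Open Scope classical_set_scope.
Local Open Scope ring_scope.

(* Upper bound: averaging exp(x disc) over all configurations and summing over
   the 2^(3n^2) switch settings gives
   exp(x F) <= 2^(3n^2) cosh(x)^(n^3) <= exp(3 n^2 ln 2 + n^3 x^2/2),
   and x = sqrt(6 ln 2 / n) is optimal.
   Lower bound: fix the l_ik to +1, take the l_jk = u_k independent of j and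
   uniformly random, and choose each l_ij greedily. For every (i,j) the signs
   a_ijk u_k are uniform, so the mean discrepancy is n^2 E|S_n|, where S_n is a
   sum of n random signs. E|S_n| is a central binomial coefficient up to a
   factor, hence at least n (2/pi) W_n for the Wallis integrals W_n, and
   W_n >= sqrt(pi / (2 (n+1))) because W_n is nonincreasing and
   W_n W_{n+1} = pi / (2 (n+1)). *)

(** * Extremal values of the discrepancy *)

Lemma maxdisc_ge n (a : config n) l : disc a l <= maxdisc a.
Proof. by rewrite /maxdisc; case: Order.TotalTheory.arg_maxP => // m _; apply. Qed.

Lemma maxdisc_attained n (a : config n) : exists l, maxdisc a = disc a l.
Proof. by rewrite /maxdisc; eexists. Qed.

Lemma F_le n (a : config n) : F n <= maxdisc a.
Proof. by rewrite /F; case: Order.TotalTheory.arg_minP => // m _; apply. Qed.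

Lemma F_attained n : exists a : config n, F n = maxdisc a.
Proof. by rewrite /F; eexists. Qed.

(** * Sums of random signs and the averaging argument *)

Lemma sgnM b c : sgn (b (+) c) = sgn b * sgn c.
Proof. by case: b; case: c; rewrite /sgn. Qed.

Lemma sum_sgn n (A : {set 'I_n}) :
  \sum_(k < n) sgn (k \in A) = n%:Z - (2 * #|A|)%:Z.
Proof.
have -> : \sum_(k < n) sgn (k \in A) = \sum_(k < n) (1 - 2 * (k \in A)%:Z).
  by apply: eq_bigr => k _; case: (k \in A); rewrite /sgn.
rewrite sumrB sumr_const card_ord -mulr_sumr; congr (_ - _); first by rewrite natz.
rewrite PoszM; congr (_ * _).
rewrite -sum1_card raddf_sum /= [RHS]big_mkcond /=.
by apply: eq_bigr => k _; case: (k \in A).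
Qed.

(* 2^n times the mean absolute value of a sum of n random signs. *)
Definition sum_abs n : int :=
  \sum_(k < n.+1) 'C(n, k)%:Z * `|n%:Z - (2 * k)%:Z|.

(** Sign vectors are grouped by their number [k] of entries -1: there are ['C(n, k)] of them, all
    with sum [n - 2 k]. *)
Lemma sum_abs_sgn n :
  \sum_(u : {ffun 'I_n -> bool}) `|\sum_(k < n) sgn (u k)| = sum_abs n.
Proof.
rewrite (reindex (fun A : {set 'I_n} => [ffun k => k \in A])) /=; last first.
  exists (fun u : {ffun 'I_n -> bool} => finset.finset u) => [A _|u _].
    by apply/setP => k; rewrite inE ffunE.
  by apply/ffunP => k; rewrite ffunE inE.
under eq_bigr => A _.
  under eq_bigr => k _ do rewrite ffunE.
  rewrite sum_sgn; over.
have card_lt (A : {set 'I_n}) : (#|A| < n.+1)%N.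
  by rewrite ltnS (leq_trans (max_card _)) ?card_ord.
rewrite (partition_big (fun A : {set 'I_n} => Ordinal (card_lt A)) xpredT) //=.
apply: eq_bigr => k _.
rewrite (eq_bigr (fun=> `|n%:Z - (2 * k)%:Z|)); last by move=> A /eqP <-.
rewrite sumr_const -mulr_natl natz; congr (Posz _ * _).
have := card_draws 'I_n k; rewrite card_ord => <-.
by apply: eq_card => A; rewrite !inE.
Qed.

Lemma disc_average n (a : config n) :
  (n * n)%:Z * sum_abs n <= (2 ^ n)%:Z * maxdisc a.
Proof.
pose row (u : {ffun 'I_n -> bool}) i j := \sum_(k < n) sgn (a (i, j, k)) * sgn (u k).
(* The greedy choice: [l_ij] is the sign of [row u i j], so each line contributes its absolute
   value. *)
pose l (u : {ffun 'I_n -> bool}) : switches n :=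
  ([ffun p => row u p.1 p.2 < 0], [ffun=> false], [ffun p => u p.2]).
have disc_l u : disc a (l u) = \sum_(i < n) \sum_(j < n) `|row u i j|.
  apply: eq_bigr => i _; apply: eq_bigr => j _.
  rewrite /row -[RHS]mulr1 /= -/(row u i j).
  rewrite (eq_bigr (fun k => sgn (row u i j < 0) * (sgn (a (i, j, k)) * sgn (u k)))).
    rewrite -mulr_sumr -/(row u i j) mulr1 /sgn.
    by case: ltrP => ?; rewrite ?expr1 ?expr0; lia.
  by move=> k _; rewrite !ffunE /= /sgn expr0; ring.
have sum_row i j : \sum_u `|row u i j| = sum_abs n.
  (* Multiplying [u] by the signs of the line (i, j) permutes the sign vectors, so [a] drops out of
     the sum. *)
  pose flip (u : {ffun 'I_n -> bool}) := [ffun k => a (i, j, k) (+) u k].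
  have flipK : involutive flip.
    by move=> u; apply/ffunP => k; rewrite !ffunE addbA addbb.
  rewrite -sum_abs_sgn [RHS](reindex_inj (inv_inj flipK)).
  by apply: eq_bigr => u _; congr `|_|; apply: eq_bigr => k _; rewrite ffunE sgnM.
have -> : (n * n)%:Z * sum_abs n = \sum_u disc a (l u).
  under eq_bigr do rewrite disc_l.
  rewrite exchange_big /= (eq_bigr (fun=> n%:Z * sum_abs n)); last first.
    move=> i _; rewrite exchange_big /= (eq_bigr (fun=> sum_abs n)) //.
    by rewrite sumr_const card_ord -mulr_natl natz.
  by rewrite sumr_const card_ord -mulr_natl natz PoszM mulrA.
apply: le_trans (ler_sum _ (fun u _ => maxdisc_ge a (l u))) _.
by rewrite sumr_const card_ffun card_bool card_ord -mulr_natl natz.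
Qed.

(* |z + 1| + |z - 1| = 2 |z|, with a correction of 2 at z = 0 only. *)
Lemma sum_absS n :
  sum_abs n.+1 = 2 * sum_abs n + 2 * (if odd n then 0 else 'C(n, n./2)%:Z).
Proof.
(* Pascal's rule splits according to the value of the last sign. *)
have -> : sum_abs n.+1 = \sum_(k < n.+1) 'C(n, k)%:Z *
    (`|n%:Z - (2 * k)%:Z + 1| + `|n%:Z - (2 * k)%:Z - 1|).
  rewrite /sum_abs; under [RHS]eq_bigr do rewrite mulrDr.
  rewrite big_split /= [in LHS]big_ord_recl [in RHS]big_ord_recl /= !bin0.
  under eq_bigr => k _ do rewrite /bump /= add1n binS PoszD mulrDl.
  rewrite big_split /= addrA; congr (_ + _); last first.
    by apply: eq_bigr => k _; congr (_ * `|_|); lia.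
  rewrite big_ord_recr /= bin_small // mul0r addr0; congr (_ + _).
    by congr (_ * `|_|); lia.
  by rewrite ?addr0; apply: eq_bigr => k _; congr (_ * `|_|); rewrite /bump /=; lia.
have -> : (if odd n then 0 else 'C(n, n./2)%:Z) =
    \sum_(k < n.+1) 'C(n, k)%:Z * (n == 2 * k)%N%:Z.
  case: ifPn => nodd.
    by rewrite big1 // => k _; case: eqP => //; rewrite ?mulr0 //; lia.
  have lt_n : (n./2 < n.+1)%N by lia.
  rewrite (bigD1 (Ordinal lt_n)) //= big1 ?addr0.
    by case: eqP; rewrite ?mulr1 //; lia.
  move=> k /eqP kn; case: eqP => [nk|]; last by rewrite mulr0.
  by case: kn; apply: val_inj => /=; lia.
rewrite /sum_abs !mulr_sumr -big_split /=; apply: eq_bigr => k _.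
set c := 'C(n, k)%:Z; rewrite [2 * (c * _)]mulrCA [2 * (c * _)]mulrCA -mulrDr.
by congr (_ * _); case: eqP; lia.
Qed.

(** * Wallis integrals and central binomial coefficients *)

Lemma ge0_is_derive_le (R : realType) (f df : R -> R) (a b : R) :
  a <= b -> (forall x : R, is_derive x 1 f (df x)) ->
  (forall x, a <= x <= b -> 0 <= df x) -> f a <= f b.
Proof.
move=> ab fdf df_ge0; rewrite -subr_ge0.
have [|c + ->] := @MVT_segment R f df a b ab (fun x _ => fdf x).
  by apply: derivable_within_continuous => x _; exact: ex_derive.
by rewrite in_itv /= => cab; rewrite mulr_ge0 ?df_ge0 // subr_ge0.
Qed.

Lemma is_derive_expRN (R : realType) (x : R) :
  is_derive x 1 (fun y => expR (- y)) (- expR (- x)).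
Proof. by apply: is_derive_eq; rewrite mulrN1. Qed.

(* The integral of sin^n over [0, pi/2]. *)
Fixpoint wallis (R : realType) n : R :=
  match n with
  | 0 => pi / 2
  | 1 => 1
  | m.+2 => m.+1%:R / m.+2%:R * wallis R m
  end.

(** The integral is represented by the increment of a primitive. The induction carries two
    consecutive exponents because the reduction formula steps by two. *)
Lemma sin_pow_primitive (R : realType) n :
  exists2 J : R -> R, (forall x : R, is_derive x 1 J (sin x ^+ n)) &
    J (pi / 2) - J 0 = wallis R n.
Proof.
pose P m := exists2 J : R -> R, (forall x : R, is_derive x 1 J (sin x ^+ m)) &
  J (pi / 2) - J 0 = wallis R m.
suff [] : P n /\ P n.+1 by [].
elim: n => [|n [[J dJ WJ] IH]].
  split; first by exists id; rewrite ?subr0 // => x; rewrite expr0; exact: is_derive_id.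
  exists (fun x => - cos x); last by rewrite cos_pihalf cos0 /=; ring.
  by move=> x; apply: is_derive_eq; rewrite expr1 opprK.
split=> //.
(* Integration by parts; the boundary term [sin ^ (n+1) * cos] vanishes at both 0 and [pi / 2]. *)
exists (n.+2%:R^-1 *: (n.+1%:R *: J - (@sin R) ^+ n.+1 * @cos R)).
  move=> x; have := dJ x => ?; apply: is_derive_eq.
  have := cos2Dsin2 x => /eqP; rewrite addrC eq_sym -subr_eq => /eqP cE.
  rewrite /GRing.scale /= exprfctE /=.
  have -> : cos x * (n.+1%:R * sin x ^+ n * cos x) =
      n.+1%:R * sin x ^+ n * (1 - sin x ^+ 2) by rewrite -cE; ring.
  by rewrite !exprS -[in n.+2%:R]natr1; field; rewrite nat1r natr1 pnatr_eq0.
rewrite !fctE /= -?WJ cos_pihalf sin_pihalf sin0 expr0n /= mul0r mulr0 !subr0.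
by rewrite /GRing.scale /=; ring.
Qed.

Lemma wallis_gt0 (R : realType) n : 0 < wallis R n.
Proof.
suff [] : 0 < wallis R n /\ 0 < wallis R n.+1 by [].
elim: n => [|n [W0 W1]]; first by rewrite /= divr_gt0 ?pi_gt0.
by split=> //=; rewrite mulr_gt0 // divr_gt0.
Qed.

Lemma wallis_noninc (R : realType) n : wallis R n.+1 <= wallis R n.
Proof.
have [J dJ <-] := sin_pow_primitive R n.
have [K dK <-] := sin_pow_primitive R n.+1.
have pi0 : (0 : R) <= pi / 2 by rewrite divr_ge0 ?pi_ge0.
have dJK (x : R) : is_derive x 1 (J - K) (sin x ^+ n - sin x ^+ n.+1).
  by have := dJ x; have := dK x => ? ?; exact: is_deriveB.
have JK_ge0 (x : R) : 0 <= x <= pi / 2 -> 0 <= sin x ^+ n - sin x ^+ n.+1.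
  move=> /andP[x0 xpi]; rewrite exprS -{1}[sin x ^+ n]mul1r -mulrBl.
  have sinx0 : 0 <= sin x.
    by rewrite sin_ge0_pi // x0 (le_trans xpi) // ler_pdivrMr // ler_peMr ?pi_ge0 ?ler1n.
  by rewrite mulr_ge0 ?exprn_ge0 // subr_ge0 sin_le1.
have := ge0_is_derive_le pi0 dJK JK_ge0; rewrite !fctE; lra.
Qed.

(** By the recursion, [(n+1) * W_(n+1) * W_n] does not depend on [n]. *)
Lemma wallisM (R : realType) n : wallis R n.+1 * wallis R n = pi / 2 / n.+1%:R.
Proof.
elim: n => [|n IHn]; first by rewrite /= mul1r divr1.
rewrite /= mulrAC -mulrA -/(wallis R n.+1) IHn; field.
by rewrite nat1r -natrD !pnatr_eq0.
Qed.

Lemma wallis_ge (R : realType) n : Num.sqrt (pi / 2 / n.+1%:R) <= wallis R n.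
Proof.
rewrite -wallisM -[leRHS]gtr0_norm ?wallis_gt0 // -sqrtr_sqr.
apply: ler_wsqrtr.
by rewrite expr2 ler_pM2r ?wallis_gt0 ?wallis_noninc.
Qed.

Lemma central_binS m :
  (m.+1 * 'C(m.+1.*2, m.+1) = 2 * (m.*2.+1 * 'C(m.*2, m)))%N.
Proof.
have := mul_bin_diag m.+1.*2 m; have := mul_bin_down m.*2.+1 m.
by rewrite !doubleS /= => h1 h2; nia.
Qed.

(** Both sides equal 1 at [m = 0] and grow by the same ratio [2 (2 m + 1) / (m + 1)]. *)
Lemma central_bin_wallis (R : realType) m :
  'C(m.*2, m)%:R = 2 ^+ m.*2 * (2 / pi * wallis R m.*2) :> R.
Proof.
elim: m => [|m IHm].
  rewrite double0 bin0 expr0 mul1r /=; move: (lt0r_neq0 (pi_gt0 R)).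
  by move: (pi : R) => p p0; field.
have m1 : m.+1%:R != 0 :> R by rewrite pnatr_eq0.
apply: (mulfI m1); rewrite -natrM central_binS !natrM IHm doubleS /= 2!exprS.
have -> : m.*2.+2%:R = 2 * m.+1%:R :> R by rewrite -natrM mul2n.
move: (lt0r_neq0 (pi_gt0 R)) (wallis R _); move: (pi : R) => p p0 w.
by field; rewrite nat1r m1 p0.
Qed.

(** * Gaussian bound on cosh *)

Lemma expRD_expRN_le (R : realType) (x : R) : 0 <= x ->
  expR x + expR (- x) <= 2 * expR (x ^+ 2 / 2).
Proof.
move=> x0.
(* tanh y <= y, so exp(-z^2/2) cosh z is nonincreasing on z >= 0. *)
have tanh_le (y : R) : 0 <= y -> expR y - expR (- y) <= y * (expR y + expR (- y)).
  move=> y0; rewrite -subr_ge0.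
  (* [k] vanishes at 0 and has derivative [2 z sinh z]. *)
  pose k z : R := z * (expR z + expR (- z)) - (expR z - expR (- z)).
  have dk (z : R) : is_derive z 1 k (z * (expR z - expR (- z))).
    have := is_derive_expRN z => ?; apply: is_derive_eq.
    by rewrite /GRing.scale /=; ring.
  have dk_ge0 (z : R) : 0 <= z <= y -> 0 <= z * (expR z - expR (- z)).
    by move=> /andP[z0 _]; rewrite mulr_ge0 // subr_ge0 ler_expR; lra.
  have := ge0_is_derive_le y0 dk dk_ge0.
  by rewrite {1}/k mul0r oppr0 subrr subr0.
(* The minus sign turns the decrease into an increase; [f 0 = -2] gives the constant. *)
pose f z : R := - (expR (- (z ^+ 2 / 2)) * (expR z + expR (- z))).
pose df z : R :=
  expR (- (z ^+ 2 / 2)) * (z * (expR z + expR (- z)) - (expR z - expR (- z))).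
have dfE (z : R) : is_derive z 1 f (df z).
  have := is_derive_expRN z => ?.
  have : is_derive z 1 (fun y : R => expR (- (y ^+ 2 / 2))) (expR (- (z ^+ 2 / 2)) * (- z)).
    by apply: is_derive_eq; rewrite /GRing.scale /=; field.
  move=> ?; apply: is_derive_eq.
  by rewrite /df /GRing.scale /=; ring.
have df_ge0 (z : R) : 0 <= z <= x -> 0 <= df z.
  by move=> /andP[z0 _]; rewrite mulr_ge0 ?expR_ge0 // subr_ge0 tanh_le.
have := ge0_is_derive_le x0 dfE df_ge0.
rewrite /f expr0n /= mul0r !oppr0 expR0 mul1r.
by rewrite lerN2 [expR (- (_ / _))]expRN ler_pdivrMl ?expR_gt0 // mulrC.
Qed.

(** * Lower bound *)

Lemma sum_abs_double m : sum_abs m.*2 = (m.*2 * 'C(m.*2, m))%:Z.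
Proof.
elim: m => [|m IHm]; first by rewrite /sum_abs big_ord1.
have := central_binS m; rewrite doubleS; move: 'C(_.+2, _) => C'.
rewrite !sum_absS oddS odd_double doubleK IHm /=; move: 'C(_, _) => C; lia.
Qed.

(** Equality holds for even [n]. For [n = 2 m + 1] the exact value has [W_(2m)] in place of
    [W_(2m+1)], and it is no smaller. *)
Lemma sum_abs_ge (R : realType) n :
  2 ^+ n * n%:R * (2 / pi * wallis R n) <= (sum_abs n)%:~R.
Proof.
have [] : n = n./2.*2 \/ n = n./2.*2.+1 by lia.
all: move: n./2 => m ->.
  by rewrite sum_abs_double -pmulrn natrM central_bin_wallis [leRHS]mulrCA [leRHS]mulrA.
rewrite sum_absS odd_double doubleK sum_abs_double.
have -> : 2 * (m.*2 * 'C(m.*2, m))%:Z + 2 * 'C(m.*2, m)%:Z =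
  (2 * m.*2.+1 * 'C(m.*2, m))%:Z by lia.
rewrite -pmulrn !natrM central_bin_wallis.
have := wallis_noninc R m.*2; move: (wallis R m.*2.+1) (wallis R m.*2) => w w' ww'.
have -> : 2 * m.*2.+1%:R * (2 ^+ m.*2 * (2 / pi * w')) =
  2 ^+ m.*2.+1 * m.*2.+1%:R * (2 / pi * w') :> R by rewrite exprS; ring.
by rewrite ler_wpM2l ?mulr_ge0 ?exprn_ge0 // ler_wpM2l // divr_ge0 ?pi_ge0.
Qed.

Lemma F_ge (R : realType) n :
  n%:R ^+ 3 * (2 / pi * wallis R n) <= (F n)%:~R.
Proof.
have [a ->] := F_attained n.
rewrite -(ler_pM2l (exprn_gt0 n (ltr0Sn R 1))).
have := disc_average a; rewrite -(ler_int R) !intrM -!pmulrn natrM natrX.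
apply: le_trans.
have := ler_wpM2l (mulr_ge0 (ler0n R n) (ler0n R n)) (sum_abs_ge R n).
by apply: le_trans; rewrite le_eqVlt; apply/orP; left; apply/eqP; ring.
Qed.

Lemma powR_5_2 (R : realType) n :
  n%:R `^ (5 / 2) = n%:R ^+ 2 * Num.sqrt n%:R :> R.
Proof.
have [->|n0] := eqVneq n 0%N.
  by rewrite powR0 ?expr0n ?mul0r // mulf_neq0 ?invr_eq0 ?pnatr_eq0.
rewrite -powR12_sqrt ?ler0n // -powR_mulrn ?ler0n // -powRD.
  by congr (_ `^ _); field.
by rewrite pnatr_eq0 n0 implybT.
Qed.

(** Wallis gives the factor [sqrt (n / (n+1))]; as it is at most 1, it is bounded below by its
    square, which makes the error term rational. *)
Lemma F_ge_powR (R : realType) n :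
  n%:R / n.+1%:R * Num.sqrt (2 / pi) * n%:R `^ (5 / 2) <= (F n)%:~R :> R.
Proof.
apply: le_trans (F_ge R n); rewrite powR_5_2.
apply: (@le_trans _ _ (n%:R ^+ 3 * (2 / pi * Num.sqrt (pi / 2 / n.+1%:R)))); last first.
  by rewrite ler_wpM2l ?exprn_ge0 // ler_wpM2l ?divr_ge0 ?pi_ge0 // wallis_ge.
have r2 : Num.sqrt (2 / pi) ^+ 2 = 2 / pi :> R by rewrite sqr_sqrtr ?divr_ge0 ?pi_ge0.
have s2 : Num.sqrt n.+1%:R ^+ 2 = n.+1%:R :> R by rewrite sqr_sqrtr.
have t2 : Num.sqrt n%:R ^+ 2 = n%:R :> R by rewrite sqr_sqrtr.
have ts : Num.sqrt n%:R <= Num.sqrt n.+1%:R :> R by rewrite ler_wsqrtr ?ler_nat.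
have r0 : 0 < Num.sqrt (2 / pi) :> R by rewrite sqrtr_gt0 divr_gt0 ?pi_gt0.
have s0 : 0 < Num.sqrt n.+1%:R :> R by rewrite sqrtr_gt0.
have t0 : 0 <= Num.sqrt n%:R :> R by rewrite sqrtr_ge0.
have -> : Num.sqrt (pi / 2 / n.+1%:R) = (Num.sqrt (2 / pi))^-1 / Num.sqrt n.+1%:R :> R.
  by rewrite -!sqrtrV ?divr_ge0 ?pi_ge0 // -sqrtrM ?invr_ge0 ?divr_ge0 ?pi_ge0 // invf_div.
move: (Num.sqrt (2 / pi)) r2 r0 => r <- r0.
move: (Num.sqrt n.+1%:R) s2 s0 ts => s <- s0; move: (Num.sqrt n%:R) t2 t0 => t <- t0 ts.
have -> : (t ^+ 2) ^+ 3 * (r ^+ 2 * (r^-1 / s)) = t ^+ 5 * r * (t / s).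
  by field; rewrite !gt_eqF.
have -> : t ^+ 2 / s ^+ 2 * r * ((t ^+ 2) ^+ 2 * t) = t ^+ 5 * r * (t / s * (t / s)).
  by field; rewrite gt_eqF.
rewrite ler_wpM2l ?mulr_ge0 ?exprn_ge0 ?(ltW r0) // ler_piMr ?divr_ge0 ?(ltW s0) //.
by rewrite ler_pdivrMr ?mul1r.
Qed.

(** * Upper bound by exponential moments *)

(** For fixed switches the discrepancy is a linear form with coefficients +1 or -1 in [n^3]
    independent signs, so the sum of exponentials factors over the cells. *)
Lemma sum_expR_disc (R : realType) n (x : R) (l : switches n) :
  \sum_(a : config n) expR (x * (disc a l)%:~R) =
  (expR x + expR (- x)) ^+ (n * n * n).
Proof.
case: l => [[lij lik] ljk].
pose s (p : 'I_n * 'I_n * 'I_n) : int :=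
  sgn (lij p.1) * sgn (lik (p.1.1, p.2)) * sgn (ljk (p.1.2, p.2)).
have discE (a : config n) : disc a (lij, lik, ljk) = \sum_p sgn (a p) * s p.
  rewrite /disc; under eq_bigr do rewrite pair_bigA.
  rewrite pair_bigA /=.
  rewrite (reindex (fun p : 'I_n * 'I_n * 'I_n => (p.1.1, (p.1.2, p.2)))) /=.
    by apply: eq_bigr => -[[i j] k] _; rewrite /s /= !mulrA.
  by exists (fun p => (p.1, p.2.1, p.2.2)) => -[] // => [[i j] k|i [j k]].
pose G (p : 'I_n * 'I_n * 'I_n) b : R := expR (x * (sgn b * s p)%:~R).
have -> : \sum_(a : config n) expR (x * (disc a (lij, lik, ljk))%:~R) =
    \sum_(a : config n) \prod_p G p (a p).
  by apply: eq_bigr => a _; rewrite discE raddf_sum mulr_sumr expR_sum.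
rewrite -(bigA_distr_bigA G) (eq_bigr (fun=> expR x + expR (- x))).
  by rewrite prodr_const !card_prod card_ord.
(* A coefficient -1 only swaps the two exponentials of the cell. *)
move=> p _; rewrite big_bool /G /s -!sgnM.
case: (lij _ (+) _ (+) _); rewrite /sgn /= ?expr0 ?expr1 ?mulr1 ?mulrNN ?mulrN1 //.
by rewrite addrC.
Qed.

Lemma F_le_expR (R : realType) n (x : R) : 0 <= x ->
  x * (F n)%:~R <= 3 * n%:R ^+ 2 * ln 2 + n%:R ^+ 3 * (x ^+ 2 / 2).
Proof.
move=> x0; rewrite -ler_expR.
have card_config : #|config n| = (2 ^ (n * n * n))%N.
  by rewrite card_ffun card_bool !card_prod card_ord.
have card_switches : #|switches n| = (2 ^ (3 * n ^ 2))%N.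
  rewrite !card_prod card_ffun card_bool !card_prod card_ord -!expnD.
  by congr (_ ^ _)%N; lia.
(* The term at a maximizing switch setting alone dominates the left side. *)
have le_F (a : config n) :
    expR (x * (F n)%:~R) <= \sum_(l : switches n) expR (x * (disc a l)%:~R).
  have [l lE] := maxdisc_attained a.
  rewrite (bigD1 l) //= ler_wpDr //; first by apply: sumr_ge0 => ? _; exact: expR_ge0.
  by rewrite ler_expR ler_wpM2l // ler_int -lE F_le.
have := ler_sum (index_enum _) (fun a (_ : xpredT a) => le_F a).
rewrite sumr_const card_config exchange_big /=.
under eq_bigr do rewrite sum_expR_disc.
rewrite sumr_const card_switches => H.
have -> : 3 * n%:R ^+ 2 * ln 2 + n%:R ^+ 3 * (x ^+ 2 / 2) =
    (3 * n ^ 2)%:R * ln 2 + (n * n * n)%:R * (x ^+ 2 / 2) :> R.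
  by rewrite !natrM; ring.
(* Multiplying by [2 ^ (n^3)], the number of configurations, pairs one factor 2 with each
   [cosh x]. *)
rewrite expRD !expRM_natl lnK ?posrE // -(ler_pM2r (exprn_gt0 (n * n * n) (ltr0Sn R 1))).
move: H; rewrite -[X in X <= _]mulr_natr -[X in _ <= X]mulr_natl !natrX => H.
apply: le_trans H _; rewrite -mulrA ler_wpM2l ?exprn_ge0 //.
rewrite -exprMn mulrC lerXn2r ?nnegrE ?addr_ge0 ?mulr_ge0 ?expR_ge0 //.
exact: expRD_expRN_le.
Qed.

Lemma F_le_powR (R : realType) n : (0 < n)%N ->
  (F n)%:~R <= Num.sqrt (6 * ln 2) * n%:R `^ (5 / 2) :> R.
Proof.
move=> n0; rewrite powR_5_2.
have ln2 : 0 < 6 * ln 2 :> R by rewrite mulr_gt0 // ln_gt0 // ltr1n.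
have c2 : Num.sqrt (6 * ln 2) ^+ 2 = 6 * ln 2 :> R by rewrite sqr_sqrtr ?ltW.
have t2 : Num.sqrt n%:R ^+ 2 = n%:R :> R by rewrite sqr_sqrtr.
have c0 : 0 < Num.sqrt (6 * ln 2) :> R by rewrite sqrtr_gt0.
have t0 : 0 < Num.sqrt n%:R :> R by rewrite sqrtr_gt0 ltr0n.
(* This [x] makes the two terms of [F_le_expR] equal, both being [3 n^2 ln 2]. *)
have x0 : 0 < Num.sqrt (6 * ln 2) / Num.sqrt n%:R :> R by rewrite divr_gt0.
rewrite -(ler_pM2l x0); apply: le_trans (F_le_expR n (ltW x0)) _.
move: (Num.sqrt (6 * ln 2)) c0 c2 {x0 ln2} => c c0 c2.
have -> : ln 2 = c ^+ 2 / 6 :> R by rewrite c2; field.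
move: (Num.sqrt n%:R) t2 t0 => t <- t0.
by rewrite le_eqVlt; apply/orP; left; apply/eqP; field; rewrite gt_eqF.
Qed.

Theorem theorem10 (R : realType) :
  [/\ (fun n : nat => (F n)%:~R : R^o)
        \is 'Theta_\oo (fun n : nat => n%:R `^ (5 / 2) : R^o),
      (forall n : nat, (0 < n)%N ->
         (F n)%:~R <= Num.sqrt (6 * ln 2) * n%:R `^ (5 / 2) :> R)
    & (exists e : nat -> R, e @ \oo --> (0 : R) /\
         forall n : nat, (0 < n)%N ->
           (1 + e n) * Num.sqrt (2 / pi) * n%:R `^ (5 / 2) <= (F n)%:~R)].
Proof.
split.
- rewrite qualifE; apply/asboolP => /=.
  (* The factor 1/2 comes from [n / (n+1) >= 1/2] for [n >= 1]. *)
  exists (2^-1 * Num.sqrt (2 / pi), Num.sqrt (6 * ln 2)) => /=.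
    by rewrite mulr_gt0 ?sqrtr_gt0 ?divr_gt0 ?pi_gt0 // mulr_gt0 // ln_gt0 // ltr1n.
  exists 1%N => // n /= n0.
  have -> : `|n%:R `^ (5 / 2) : R^o| = n%:R `^ (5 / 2).
    by apply: ger0_norm; exact: powR_ge0.
  have F_lb := F_ge_powR R n.
  have F_ge0 : 0 <= (F n)%:~R :> R.
    by apply: le_trans F_lb; rewrite !mulr_ge0 ?invr_ge0 ?sqrtr_ge0 ?powR_ge0.
  have -> : `|(F n)%:~R : R^o| = (F n)%:~R by exact: ger0_norm.
  split; last exact: F_le_powR.
  apply: le_trans F_lb; rewrite ler_wpM2r ?powR_ge0 // ler_wpM2r ?sqrtr_ge0 //.
  by rewrite ler_pdivlMr ?ltr0n // ler_pdivrMl // -natrM ler_nat; lia.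
- exact: F_le_powR.
(* [harmonic n] is [1 / (n+1)], so [1 + e n] is exactly [n / (n+1)]. *)
- exists (fun n => - harmonic n); split.
    by rewrite -oppr0; apply: cvgN; exact: cvg_harmonic.
  move=> n _; apply: le_trans (F_ge_powR R n); rewrite le_eqVlt; apply/orP; left.
  by apply/eqP; congr (_ * _ * _); rewrite /harmonic /= -natr1; field; rewrite natr1.
Qed.
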